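(* Let $r>0$ be an integer and for $i\in\{1,\dots,r\}$ let $X_i$ be a nonempty finite set and $G_i\le\mathrm{Sym}(X_i)$. Let $G=G_1\times\dots\times G_r$ act on $X_1\times\dots\times X_r$ via $(x_1,\dots,x_r)(g_1,\dots,g_r)=(x_1g_1,\dots,x_rg_r)$. If $C\subseteq G$ is a nonempty subset of the form $C=C_1\times\dots\times C_r$ with each $C_i\subseteq G_i$, then for every integer $k\ge 0$ $$\delta_k(C)=\sum_{i_1\cdots i_r=k}\ \prod_{s=1}^r\delta_{i_s}(C_s),$$ where the sum is over all tuples $(i_1,\dots,i_r)$ with $0\le i_s\le|X_s|$ and $i_1\cdots i_r=k$; and for $k=0$ $$\delta(C)=1-\prod_{i=1}^r(1-\delta(C_i)).$$
   Context: Permutations act on the right. For a nonempty finite set $C$ of permutations of a finite set $X$, $\delta_k(C)$ is the proportion of elements of $C$ with exactly $k$ fixed points in $X$, and $\delta(C)=\delta_0(C)$. Here $\delta_k(C)$ is taken with respect to the action on $X_1\times\dots\times X_r$, and $\delta_{i}(C_s)$ with respect to the action on $X_s$. *)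

(* Defs.v *)
From mathcomp Require Import all_boot all_order all_algebra all_fingroup.

Set Implicit Arguments.
Unset Strict Implicit.
Unset Printing Implicit Defensive.

Import GroupScope.

Section FixedPointProportion.

Variables (aT : finGroupType) (T : finType) (to : {action aT &-> T}).
Implicit Types (k : nat) (C : {set aT}).

(* For T = X and to = 'P, the natural (right) action of {perm X}, this is the
   proportion of permutations in C with exactly k fixed points.
   It is only meaningful for C nonempty (it is 0 when C is empty). *)
Definition delta k C : rat :=
  (#|[set g in C | #|'Fix_to[g]| == k]|%:R / #|C|%:R)%R.

Definition derangement_prop C : rat := delta 0 C.

End FixedPointProportion.

Section ProductAction.

Variables (I : finType) (aT : I -> finGroupType) (T : I -> finType).
Variable to : forall i, {action aT i &-> T i}.

Definition prodact (x : {dffun forall i, T i}) (g : {dffun forall i, aT i}) :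
    {dffun forall i, T i} :=
  [ffun i => to i (x i) (g i)].

Fact prodact1 : prodact^~ 1 =1 id.
Proof. by move=> x; apply/ffunP => i; rewrite !ffunE act1. Qed.

Fact prodactM x : act_morph prodact x.
Proof. by move=> g h; apply/ffunP => i; rewrite /= !ffunE actM. Qed.

Definition prod_action := TotalAction prodact1 prodactM.

End ProductAction.

(* Main.v *)
(* The fixed points of a tuple g are the tuples of fixed points of its components, so
   g has exactly k of them iff the numbers of fixed points of the components have
   product k; partitioning C by these numbers cuts it into direct products.
   For k = 0 one counts instead the complement, which is itself a direct product. *)

Require Import Defs.
From mathcomp Require Import all_boot all_order all_algebra all_fingroup.

Import GRing.Theory Num.Theory.
Local Open Scope ring_scope.

Set Implicit Arguments.
Unset Strict Implicit.
Unset Printing Implicit Defensive.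

(* The library notation 'Fix_to[g] does not parse with a compound action. *)
Local Notation Fix to g := 'Fix_to[g]%g.

Section DeltaProduct.

Variables (I : finType) (aT : I -> finGroupType) (T : I -> finType).
Variable to : forall i, {action aT i &-> T i}.
Implicit Types (g : {dffun forall i, aT i}) (D : forall i, {set aT i}).

Lemma afix1_prod_action g :
  Fix (prod_action to) g = setXn (fun i => Fix (to i) (g i)).
Proof.
apply/setP => x; apply/afix1P/setXnP => [xg i | xg].
  (* Only the right-hand [x] is replaced by its image under [g], so that evaluating at [i] exposes
     the action of [g i] on [x i]. *)
  by apply/afix1P; rewrite -[in RHS]xg ffunE.
by apply/ffunP => i; rewrite ffunE; apply/afix1P.
Qed.

Lemma card_afix1_prod_action g :
  #|Fix (prod_action to) g| = (\prod_i #|Fix (to i) (g i)|)%N.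
Proof. by rewrite afix1_prod_action cardsXn. Qed.

Lemma setXn_neq0 D : setXn D != set0 -> forall i, D i != set0.
Proof. by case/set0Pn => g /setXnP Dg i; apply/set0Pn; exists (g i). Qed.

Lemma card_prod_action_fix k D :
  #|[set g in setXn D | #|Fix (prod_action to) g| == k]| =
  (\sum_(n : {dffun forall i, 'I_(#|T i|.+1)} | \prod_i n i == k)
     \prod_i #|[set g in D i | #|Fix (to i) g| == n i]|)%N.
Proof.
(* The profile of fixed-point counts of [g]. The counts run from 0 to [#|T i|] inclusive, hence the
   successor in the ordinal type, and [inord] never falls back to its default. *)
pose fixn g : {dffun forall i, 'I_(#|T i|.+1)} :=
  [ffun i => inord #|Fix (to i) (g i)|].
have fixnE g i : fixn g i = #|Fix (to i) (g i)| :> nat.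
  by rewrite ffunE inordK // ltnS max_card.
rewrite -sum1_card (partition_big fixn
  (fun n : {dffun forall i, 'I_(#|T i|.+1)} => \prod_i n i == k)%N) /=; last first.
  move=> g; rewrite inE card_afix1_prod_action => /andP[_ /eqP <-].
  by apply/eqP/eq_bigr => i _; rewrite fixnE.
(* The fibre of [fixn] over [n] is itself a direct product: its condition constrains each component
   of [g] separately. *)
apply: eq_bigr => n /eqP nk; rewrite -cardsXn -sum1_card; apply: eq_bigl => g.
rewrite inE card_afix1_prod_action.
apply/andP/setXnP => [[/andP[/setXnP Dg _] /eqP <-] i | Dg].
  by rewrite inE Dg fixnE eqxx.
have fixg i : #|Fix (to i) (g i)| = n i by have /setIdP[_ /eqP] := Dg i.
split; last by apply/eqP/ffunP => i; apply: val_inj; rewrite /= fixnE.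
apply/andP; split; first by apply/setXnP => i; have /setIdP[] := Dg i.
by rewrite -nk; apply/eqP/eq_bigr.
Qed.

Lemma delta_setXn k D :
  delta (prod_action to) k (setXn D) =
  \sum_(n : {dffun forall i, 'I_(#|T i|.+1)} | (\prod_i n i)%N == k)
    \prod_i delta (to i) (n i) (D i).
Proof.
rewrite /delta card_prod_action_fix natr_sum mulr_suml; apply: eq_bigr => n _.
by rewrite prodf_div cardsXn !natr_prod.
Qed.

End DeltaProduct.

(** Complementary counting after writing 1 as [#|C| / #|C|]. For empty [C] the left side would be 1
    and the right side 0, since division by zero yields 0. *)
Lemma derangement_propC (aT : finGroupType) (T : finType)
    (to : {action aT &-> T}) (C : {set aT}) :
  C != set0 ->
  1 - derangement_prop to C =
  #|[set g in C | #|Fix to g| != 0%N]|%:R / #|C|%:R.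
Proof.
rewrite -card_gt0 -(ltr0n rat) => /lt0r_neq0 C_neq0.
rewrite -[X in X - _](divff C_neq0) /derangement_prop /delta -mulrBl; congr (_ / _).
rewrite -(cardsID [set g | #|Fix to g| == 0%N] C) natrD.
rewrite -setIdE addrAC subrr add0r; congr (_%:R).
by apply: eq_card => g; rewrite !inE andbC.
Qed.

(* A tuple has a fixed point iff each of its components has one. *)
Lemma derangement_prop_setXn (I : finType) (aT : I -> finGroupType)
    (T : I -> finType) (to : forall i, {action aT i &-> T i})
    (D : forall i, {set aT i}) :
  setXn D != set0 ->
  derangement_prop (prod_action to) (setXn D) =
  1 - \prod_i (1 - derangement_prop (to i) (D i)).
Proof.
(* Moves the complement to the other side: the goal becomes [1 - derangement_prop] of the product
   equals the product of the factors' complements. *)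
move=> D_neq0; apply/esym/eqP; rewrite subr_eq addrC -subr_eq; apply/eqP.
rewrite derangement_propC //.
under [RHS]eq_bigr do rewrite derangement_propC ?setXn_neq0 //.
rewrite prodf_div -!natr_prod -!cardsXn; congr (_%:R / _).
apply: eq_card => g; rewrite inE card_afix1_prod_action -lt0n.
apply/andP/setXnP => [[/setXnP Dg fixg] i | Dg].
  (* A positive product of naturals has every factor positive; [bigD1] isolates the factor at
     [i]. *)
  by rewrite inE Dg -lt0n; move: fixg; rewrite (bigD1 i) //= muln_gt0 => /andP[].
split; first by apply/setXnP => i; have /setIdP[] := Dg i.
by apply: prodn_gt0 => i; have /setIdP[_] := Dg i; rewrite -lt0n.
Qed.

Theorem theorem4p1 (r : nat) (r_gt0 : (0 < r)%N)
    (X : 'I_r -> finType) (X_nonempty : forall s, (0 < #|X s|)%N)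
    (G : forall s : 'I_r, {group {perm X s}})
    (C : {set {dffun forall s : 'I_r, {perm X s}}})
    (Cs : forall s : 'I_r, {set {perm X s}})
    (C_nonempty : C != set0)
    (C_sub_G : C \subset setXn_group G)
    (C_prod : C = setXn Cs)
    (Cs_sub_G : forall s, Cs s \subset G s) :
  let to := prod_action (fun s => perm_action (X s)) in
  (forall k : nat,
     delta to k C =
     \sum_(i : {dffun forall s : 'I_r, 'I_(#|X s|.+1)} | (\prod_s i s)%N == k)
       \prod_s delta 'P (i s) (Cs s)) /\
  derangement_prop to C =
    1 - \prod_s (1 - derangement_prop 'P (Cs s)).
Proof.
move=> to; split=> [k|]; rewrite C_prod; first exact: delta_setXn.
by apply: derangement_prop_setXn; rewrite -C_prod.
Qed.
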